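(* Let $\mathcal{G}$ be an infinite family of (finite, simple) graphs. Then $\mathcal{G}$ is quasi-random if and only if there is a function $f:\mathbb{N}\to[0,\infty)$ with $f(n)/n\to0$ as $n\to\infty$ such that \[ |\mu_n(G)+\mu_n(\overline{G})|\le f(n) \] for every graph $G\in\mathcal{G}$ of order $n$ (i.e. $\mu_n(G)+\mu_n(\overline{G})=o(n)$).
   Context: For a graph $H$ on $n$ vertices, $\mu_1(H)\ge\dots\ge\mu_n(H)$ are the eigenvalues of its adjacency matrix, $e(H)$ is its number of edges, and $\overline{H}$ is its complement. An infinite family $\mathcal{G}$ of graphs is called quasi-random if for every $G\in\mathcal{G}$ of order $n$, $\mu_1(G)=2e(G)/n+o(n)$, $\mu_2(G)=o(n)$, and $\mu_n(G)=o(n)$; here $o(n)$ means bounded in absolute value by a function $g(n)$ with $g(n)/n\to0$, uniformly over all members of the family of order $n$. *)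

(* Defs.v *)
From HB Require Import structures.
From mathcomp Require Import all_boot all_order all_algebra.
From mathcomp Require Import polyrcf.
From mathcomp Require Import all_classical all_reals all_analysis.

Set Implicit Arguments.
Unset Strict Implicit.
Unset Printing Implicit Defensive.

Import Order.TTheory GRing.Theory Num.Theory.
Import numFieldNormedType.Exports.

Local Open Scope classical_set_scope.
Local Open Scope ring_scope.

(* Finite simple graphs of order [n], on the vertex set {0, ..., n-1}: every
   finite graph has such a labelling, and spectra and edge counts do not depend
   on it. *)
Record sgraph (n : nat) := SGraph {
  adj :> rel 'I_n;
  adj_sym : symmetric adj;
  adj_irrefl : irreflexive adj
}.

Section Complement.
Variables (n : nat) (G : sgraph n).

Definition compl_adj : rel 'I_n := [rel x y | (x != y) && ~~ G x y].

Lemma compl_adj_sym : symmetric compl_adj.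
Proof. by move=> x y; rewrite /compl_adj /= eq_sym adj_sym. Qed.

Lemma compl_adj_irrefl : irreflexive compl_adj.
Proof. by move=> x; rewrite /compl_adj /= eqxx. Qed.

Definition compl_graph : sgraph n := SGraph compl_adj_sym compl_adj_irrefl.

End Complement.

Definition edges (n : nat) (G : sgraph n) : {set {set 'I_n}} :=
  [set [set p.1; p.2] | p : 'I_n * 'I_n & G p.1 p.2]%SET.

Definition nb_edges (n : nat) (G : sgraph n) : nat := #|edges G|.

Definition adjmx (R : realType) (n : nat) (G : sgraph n) : 'M[R]_n :=
  \matrix_(i, j) (G i j)%:R.

(* [rootsR p] lists the distinct real roots of [p] in increasing order; here
   each root is repeated according to its multiplicity and the list is reversed.
   For a symmetric matrix of size n the list has length n. *)
Definition eigenvalues (R : realType) (n : nat) (A : 'M[R]_n) : seq R :=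
  rev (flatten [seq nseq (mup x (char_poly A)) x | x <- rootsR (char_poly A)]).

(* mu_k(G) for 1 <= k <= n, with k counted from 1. When there is no k-th
   eigenvalue (k = 2 and n <= 1, or n = 0) the value is 0. *)
Definition mu (R : realType) (k : nat) (n : nat) (G : sgraph n) : R :=
  nth 0 (eigenvalues (adjmx R G)) k.-1.

Definition graph_family := set {n : nat & sgraph n}.

(* phi(G) = o(n), uniformly over the members G of the family of order n. *)
Definition uniformly_little_o (R : realType) (F : graph_family)
    (phi : forall n : nat, sgraph n -> R) : Prop :=
  exists g : nat -> R,
    (g n / n%:R @[n --> \oo] --> (0 : R)) /\
    (forall (n : nat) (G : sgraph n), F (existT _ n G) -> `|phi n G| <= g n).

Definition quasi_random (R : realType) (F : graph_family) : Prop :=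
  [/\ uniformly_little_o F
        (fun n G => mu R 1 G - 2 * (nb_edges G)%:R / n%:R),
      uniformly_little_o F (fun n G => mu R 2 G)
    & uniformly_little_o F (fun n G => mu R n G)].

(* Main.v *)
(* Identify a matrix with its quadratic form and let u be the all-ones vector,
   so that the forms of a graph and of its complement add up to
   v |-> <u,v>^2 - |v|^2, and the form of G takes the value 2e(G) at u.

   If mu_n(G) + mu_n(compl G) = o(n), both terms are nonpositive, hence both are
   o(n), i.e. -o(n)|v|^2 <= A(v,v) <= <u,v>^2 + o(n)|v|^2. On the hyperplane
   orthogonal to u the form is therefore o(n), which bounds mu_2 by
   Courant-Fischer; Cauchy-Schwarz for the nonnegative form A + o(n) makes the
   cross terms A(u,w), w orthogonal to u, negligible, which gives mu_1.

   Conversely, if G is quasi-random then mu_1 - A is a nonnegative form that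
   is small at u, so Cauchy-Schwarz again makes the cross terms negligible; as
   mu_2 is small, A is small on one direction of each plane containing u,
   and this forces A(v,v) <= <u,v>^2 + o(n)|v|^2, that is
   mu_n(compl G) >= -o(n). *)
Require Import Defs.
From mathcomp Require Import all_boot all_order all_algebra.
From mathcomp Require Import fingroup perm polyrcf.
From mathcomp Require Import all_classical all_reals all_analysis.
From mathcomp Require Import lra.
Set Implicit Arguments.
Unset Strict Implicit.
Unset Printing Implicit Defensive.

Import Order.TTheory GRing.Theory Num.Theory.
Import numFieldNormedType.Exports.
Local Open Scope classical_set_scope.
Local Open Scope ring_scope.

(** * Bilinear forms and the real spectral theorem *)

Definition bform (R : realType) n (A : 'M[R]_n) (u v : 'rV[R]_n) : R :=
  (u *m A *m v^T) 0 0.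

Section Form.
Variables (R : realType) (n : nat) (A : 'M[R]_n).
Implicit Types (u v w : 'rV[R]_n) (B : 'M[R]_n).

Lemma bformE u v : bform A u v = \sum_i \sum_j u 0 i * A i j * v 0 j.
Proof.
rewrite /bform mxE exchange_big; apply: eq_bigr => j _.
by rewrite !mxE mulr_suml; apply: eq_bigr => i _.
Qed.

Lemma bform1E u v : bform 1%:M u v = \sum_i u 0 i * v 0 i.
Proof. by rewrite /bform mulmx1 mxE; apply: eq_bigr => i _; rewrite mxE. Qed.

Lemma bform1_ge0 v : 0 <= bform 1%:M v v.
Proof. by rewrite bform1E sumr_ge0 // => i _; rewrite -expr2 sqr_ge0. Qed.

Lemma bform1_eq0 v : (bform 1%:M v v == 0) = (v == 0).
Proof.
apply/eqP/eqP => [|->]; last by rewrite /bform !mul0mx mxE.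
rewrite bform1E => /psumr_eq0P vv; apply/rowP => i.
have /eqP : v 0 i * v 0 i = 0 by apply: vv => // j _; rewrite -expr2 sqr_ge0.
by rewrite mulf_eq0 orbb => /eqP ->; rewrite mxE.
Qed.

Lemma bformD2 B u v : bform (A + B) u v = bform A u v + bform B u v.
Proof. by rewrite /bform mulmxDr mulmxDl mxE. Qed.

Lemma bformN B u v : bform (- B) u v = - bform B u v.
Proof. by rewrite /bform mulmxN mulNmx mxE. Qed.

Lemma bformscale c B u v : bform (c *: B) u v = c * bform B u v.
Proof. by rewrite /bform -scalemxAr -scalemxAl mxE. Qed.

Lemma bform_deltar u i : bform A u (delta_mx 0 i) = (u *m A) 0 i.
Proof. by rewrite /bform trmx_delta -colE mxE. Qed.

Lemma bform_combr s t x u w :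
  bform A x (s *: u + t *: w) = s * bform A x u + t * bform A x w.
Proof.
rewrite /bform linearD !linearZ /= mulmxDr -!scalemxAr.
by rewrite [LHS]mxE [X in X + _]mxE [X in _ + X]mxE.
Qed.

Hypothesis symA : A^T = A.

Lemma bformC u v : bform A u v = bform A v u.
Proof.
rewrite /bform; have -> : v *m A *m u^T = (u *m A *m v^T)^T.
  by rewrite !trmx_mul trmxK symA mulmxA.
by rewrite [RHS]mxE.
Qed.

Lemma bform_comb s t u w : bform A (s *: u + t *: w) (s *: u + t *: w) =
  s ^+ 2 * bform A u u + 2 * s * t * bform A u w + t ^+ 2 * bform A w w.
Proof.
have -> : 2 * s * t * bform A u w = s * t * bform A u w + s * t * bform A w u.
  by rewrite (bformC w u); lra.
rewrite /bform linearD !linearZ /= !mulmxDl !mulmxDr -!scalemxAl -!scalemxAr.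
by rewrite !mxE; lra.
Qed.

(** When c > 0, nonnegativity of s^2 a + 2 s t b + t^2 c at (c, - b) gives the claim. The form is
    only semidefinite, so c = 0 is treated apart. *)
Lemma bform_cauchy_schwarz u w : (forall v, 0 <= bform A v v) ->
  bform A u w ^+ 2 <= bform A u u * bform A w w.
Proof.
move=> psd; have a0 := psd u; have c0 := psd w.
set a := bform A u u in a0 *; set b := bform A u w.
set c := bform A w w in c0 *.
have H s t : 0 <= s ^+ 2 * a + 2 * s * t * b + t ^+ 2 * c.
  by rewrite -bform_comb psd.
move: c0; rewrite le0r => /orP[/eqP c0|c0]; last first.
  have := H c (- b).
  have -> : c ^+ 2 * a + 2 * c * - b * b + (- b) ^+ 2 * c = c * (a * c - b ^+ 2).
    by lra.
  by rewrite pmulr_rge0 // subr_ge0.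
(* With c = 0 this choice of t turns the quadratic into - b^2 (1 + 2 b^2), which forces b = 0. *)
have := H b (- (a + 1) / 2 - b ^+ 2); rewrite c0 mulr0.
have := sqr_ge0 b; nra.
Qed.

End Form.

Section RealSpectral.
Variable R : realType.

Lemma bform_continuous n (A : 'M[R]_n) : continuous (fun v => bform A v v).
Proof.
have sumc (f : 'I_n -> 'rV[R]_n -> R) : (forall i, continuous (f i)) ->
    continuous (fun v => \sum_i f i v).
  move=> fc; apply: (@continuous_big R 'I_n +%R 0 xpredT (@add_continuous R)).
  by move=> i _; exact: fc.
under eq_fun do rewrite bformE.
apply: (sumc _ _) => i; apply: (sumc _ _) => j x.
have cc k : {for x, continuous (fun v : 'rV[R]_n => v 0 k)}.
  exact: coord_continuous.
apply: (continuousM (s := fun v : 'rV[R]_n => v 0 i * A i j)) (cc j).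
exact: (@continuousM R _ (fun v : 'rV[R]_n => v 0 i) (fun=> A i j) x
  (cc i) (@cst_continuous _ _ (A i j) x)).
Qed.

(** A maximiser x of the form on the unit sphere is an eigenvector: with a the maximum, [a%:M - A]
    is nonnegative and vanishes at x, so by Cauchy-Schwarz it pairs x to 0 with every basis
    vector. *)
Lemma sym_eigenvector n (A : 'M[R]_n.+1) : A^T = A ->
  exists v a, bform 1%:M v v = 1 /\ v *m A = a *: v.
Proof.
move=> symA.
pose S : set 'rV[R]_n.+1 := [set v | bform 1%:M v v = 1].
have S0 : S !=set0.
  exists (delta_mx 0 0); rewrite /S /= bform_deltar mulmx1 mxE !eqxx //.
have cS : compact S.
  have cube := @rV_compact R n.+1 (fun=> `[-1, 1]%classic)
    (fun=> @segment_compact _ _ _).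
  apply: (subclosed_compact _ cube).
    apply: (preimage_closed (f := fun v => bform 1%:M v v) (D := [set x | x = 1])).
      by move=> v _; exact: bform_continuous.
    exact: closed_eq.
  move=> v; rewrite /S /= bform1E => v1 i.
  have : v 0 i ^+ 2 <= 1.
    rewrite -v1 (bigD1 i) //= -expr2 lerDl sumr_ge0 // => j _.
    by rewrite -expr2 sqr_ge0.
  rewrite in_itv /= -ler_norml -sqrtr_sqr -[1 in X in _ -> X]sqrtr1.
  exact: ler_wsqrtr.
have [x /set_mem x1 xmax] := compact_EVT_max S0 cS
  (continuous_subspaceT (@bform_continuous _ A)).
pose a := bform A x x; pose B := a%:M - A.
have symB : B^T = B by rewrite /B linearB /= tr_scalar_mx symA.
have BE u v : bform B u v = a * bform 1%:M u v - bform A u v.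
  by rewrite /B bformD2 bformN -[a%:M]scalemx1 bformscale.
have psdB v : 0 <= bform B v v.
  have [->|v0] := eqVneq v 0.
    by rewrite /bform !mul0mx mxE.
  have vv0 : 0 < bform 1%:M v v.
    by rewrite lt0r bform1_ge0 bform1_eq0 v0.
  pose r := bform 1%:M v v.
  pose c := (Num.sqrt r)^-1.
  have cr : c ^+ 2 * r = 1.
    by rewrite exprVn sqr_sqrtr ?mulVf ?gt_eqF // ltW.
  have bformZ C : bform C (c *: v) (c *: v) = c ^+ 2 * bform C v v.
    by rewrite /bform linearZ /= -!scalemxAl -scalemxAr !mxE; lra.
  have := xmax (c *: v); rewrite !bformZ => /(_ _)/wrap[].
    by rewrite inE /S /= bformZ.
  move=> /(ler_wpM2r (ltW vv0)); rewrite -/r -/a mulrAC cr mul1r.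
  by rewrite BE subr_ge0.
exists x, a; split=> //; apply/rowP => i.
have := bform_cauchy_schwarz symB x (delta_mx 0 i) psdB.
rewrite (BE x x) x1 mulr1 subrr mul0r => b0.
have /eqP : bform B x (delta_mx 0 i) ^+ 2 = 0.
  by apply/le_anti; rewrite b0 sqr_ge0.
rewrite sqrf_eq0 BE !bform_deltar mulmx1 subr_eq0 => /eqP xA.
by rewrite -xA mxE.
Qed.

(* Witness: the Householder reflection in the hyperplane orthogonal to
   v - delta_mx 0 0. *)
Lemma householder n (v : 'rV[R]_n.+1) : bform 1%:M v v = 1 ->
  exists2 H : 'M[R]_n.+1, H *m H^T = 1%:M & delta_mx 0 0 *m H = v.
Proof.
move=> v1; pose e : 'rV[R]_n.+1 := delta_mx 0 0.
have [->|ve] := eqVneq v e.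
  by exists 1%:M; rewrite ?trmx1 mulmx1.
pose w := v - e; pose q := bform 1%:M w w.
have q0 : q != 0 by rewrite bform1_eq0 subr_eq0.
have ww : w *m w^T = q%:M by rewrite [LHS]mx11_scalar /q /bform mulmx1.
have ew : e *m w^T = (v 0 0 - 1)%:M.
  rewrite [LHS]mx11_scalar; congr _%:M.
  by rewrite -rowE !mxE !eqxx.
have qE : q = 2 * (1 - v 0 0).
  have -> : q = bform 1%:M (1 *: v + -1 *: e) (1 *: v + -1 *: e).
    by rewrite scale1r scaleN1r.
  rewrite bform_comb ?trmx1 // v1 !bform_deltar !mulmx1 !mxE !eqxx /=; lra.
have vE : v = e + w by rewrite addrC subrK.
clearbody w q; exists (1%:M - (2 / q) *: (w^T *m w)).
  have -> : (1%:M - (2 / q) *: (w^T *m w))^T = 1%:M - (2 / q) *: (w^T *m w).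
    by rewrite linearB linearZ /= trmx1 trmx_mul trmxK.
  rewrite mulmxBl mul1mx mulmxBr mulmx1 -scalemxAl -scalemxAr.
  rewrite -mulmxA [w *m (_ *m _)]mulmxA ww mul_scalar_mx -scalemxAr !scalerA.
  by rewrite divfK // mulr_natr mulr2n scalerDl opprB addrK subrK.
rewrite mulmxBr mulmx1 -scalemxAr mulmxA ew mul_scalar_mx scalerA.
have -> : 2 / q * (v 0 0 - 1) = -1.
  have -> : v 0 0 - 1 = - (q / 2) by rewrite qE; lra.
  by rewrite mulrN mulf_div [q * 2]mulrC divff // mulf_neq0 ?pnatr_eq0.
by rewrite scaleN1r opprK vE.
Qed.

(** Induction on the size: a reflection taking the first basis vector to a unit eigenvector
    conjugates A to a block diagonal matrix with a 1 x 1 corner. *)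
Lemma real_spectral n (A : 'M[R]_n) : A^T = A ->
  exists P : 'M[R]_n, exists2 d : 'rV[R]_n,
    P *m P^T = 1%:M & A = P^T *m diag_mx d *m P.
Proof.
elim: n A => [|n IHn] A symA.
  by exists 1%:M, 0; rewrite ?trmx1 ?mulmx1 // flatmx0 [RHS]flatmx0.
have [v [a [v1 vA]]] := sym_eigenvector symA.
have [H HH eH] := householder v1.
pose B : 'M[R]_(1 + n) := H *m A *m H^T.
have symB : B^T = B by rewrite /B !trmx_mul trmxK symA mulmxA.
(* The first row of B is a times the first basis vector; symmetry then clears the first column. *)
have BE : B = block_mx a%:M 0 0 (drsubmx B).
  have eB : delta_mx 0 0 *m B = a *: delta_mx 0 0 :> 'rV_(1 + n).
    rewrite /B !mulmxA eH vA -scalemxAl -eH -mulmxA HH mulmx1 //.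
  have Bu : usubmx B = row_mx a%:M 0.
    apply/rowP => j; rewrite !mxE.
    have /rowP/(_ j) := eB; rewrite -rowE !mxE.
    have -> : lshift n (0 : 'I_1) = 0 by apply/val_inj.
    move=> ->; rewrite eqxx.
    by case: splitP => k; rewrite ?ord1 mxE -val_eqE /= => ->;
      rewrite ?mulr1 ?mulr0.
  rewrite -[LHS]submxK; congr block_mx.
  - by rewrite /ulsubmx Bu row_mxKl.
  - by rewrite /ursubmx Bu row_mxKr.
  - by rewrite -[dlsubmx B]trmxK trmx_dlsub symB /ursubmx Bu row_mxKr trmx0.
have symB' : (drsubmx B)^T = drsubmx B by rewrite trmx_drsub symB.
have [P [d PP B'E]] := IHn _ symB'.
pose Q : 'M[R]_(1 + n) := block_mx 1%:M 0 0 P.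
have QQ : Q *m Q^T = 1%:M.
  rewrite /Q tr_block_mx mulmx_block !trmx0 trmx1 !mulmx1 !mulmx0 !mul0mx.
  by rewrite !addr0 add0r PP -scalar_mx_block.
exists (Q *m H), (row_mx a%:M d).
  by rewrite trmx_mul mulmxA -[Q *m H *m _]mulmxA HH mulmx1.
rewrite trmx_mul.
have -> : H^T *m Q^T *m diag_mx (row_mx a%:M d) *m (Q *m H)
   = H^T *m (Q^T *m diag_mx (row_mx a%:M d) *m Q) *m H by rewrite !mulmxA.
have -> : Q^T *m diag_mx (row_mx a%:M d) *m Q = B.
  rewrite BE B'E /Q diag_mx_row tr_block_mx !mulmx_block.
  rewrite !trmx0 trmx1 !mulmx1 !mul1mx !mulmx0 !mul0mx !addr0 !add0r.
  rewrite ?mulmx0 ?mul0mx; congr block_mx.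
  by apply/matrixP => i j; rewrite !mxE !ord1.
rewrite /B; have HtH : H^T *m H = 1%:M by exact: mulmx1C.
by rewrite !mulmxA HtH mul1mx -mulmxA HtH mulmx1.
Qed.

Lemma orthogonal_char_poly n (P : 'M[R]_n) (d : 'rV[R]_n) : P *m P^T = 1%:M ->
  char_poly (P^T *m diag_mx d *m P) = \prod_(x <- codom (d 0)) ('X - x%:P).
Proof.
move=> PP; have PtP : P^T *m P = 1%:M by exact: mulmx1C.
have -> : char_poly (P^T *m diag_mx d *m P) = char_poly (diag_mx d).
  rewrite /char_poly.
  have -> : char_poly_mx (P^T *m diag_mx d *m P) =
      map_mx polyC P^T *m char_poly_mx (diag_mx d) *m map_mx polyC P.
    rewrite /char_poly_mx !map_mxM mulmxBr mulmxBl; congr (_ - _).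
    rewrite scalar_mxC -mulmxA -map_mxM PtP map_mx1 mulmx1 //.
  rewrite !det_mulmx mulrAC -det_mulmx -map_mxM PtP map_mx1 det1 mul1r //.
rewrite char_poly_trig ?diag_mx_is_trig // big_map big_enum /=.
by apply: eq_bigr => i _; rewrite mxE eqxx mulr1n.
Qed.

Lemma count_flatten_nseq (T : eqType) (f : T -> nat) (r : seq T) x : uniq r ->
  count_mem x (flatten [seq nseq (f y) y | y <- r]) = ((x \in r) * f x)%N.
Proof.
elim: r => //= y r IHr /andP[yr ur]; rewrite count_cat IHr // count_nseq inE /=.
have [->|xy] := eqVneq x y; last by [].
by rewrite (negPf yr) addn0.
Qed.

(** In both lists x occurs as often as its multiplicity as a root of the characteristic
    polynomial. *)
Lemma perm_eigenvalues n (A : 'M[R]_n) (s : seq R) :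
  char_poly A = \prod_(x <- s) ('X - x%:P) -> perm_eq (eigenvalues A) s.
Proof.
move=> As; rewrite /eigenvalues perm_rev.
apply/allP => x _ /=; apply/eqP; rewrite count_flatten_nseq; last first.
  exact: (sorted_uniq lt_trans ltxx (sorted_roots _ _ _)).
have A0 : char_poly A != 0 by rewrite monic_neq0 // char_poly_monic.
have := roots_on_rootsR A0 x; rewrite /= => <-.
rewrite -mu_prod_XsubC -As.
by case: (boolP (root _ _)) => [|/mupNroot ->]; rewrite ?mul1n.
Qed.

Lemma sorted_eigenvalues n (A : 'M[R]_n) : sorted >=%R (eigenvalues A).
Proof.
rewrite /eigenvalues rev_sorted.
have : sorted <%R (rootsR (char_poly A)) by exact: sorted_roots.
rewrite (sorted_pairwise lt_trans) => sr.
apply: (@pairwise_sorted _ <=%R); move: sr.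
elim: (rootsR _) => //= y r IHr /andP[yr /IHr sr].
rewrite pairwise_cat sr andbT; apply/andP; split.
  apply/allrelP => a b /nseqP[-> _] /flattenP[_ /mapP[z zr ->]] /nseqP[-> _].
  by rewrite ltW //; exact: (allP yr).
by elim: (mup _ _) => //= k ->; rewrite andbT; apply/allP => z /nseqP[-> _].
Qed.

(** The diagonal given by [real_spectral] is a rearrangement of [eigenvalues A]. Permuting the rows
    of P absorbs it, so that coordinate 0 carries the largest eigenvalue. *)
Lemma spectral_eigenvalues n (A : 'M[R]_n) : A^T = A ->
  exists2 P : 'M[R]_n, P *m P^T = 1%:M &
    forall v, bform A v v =
      \sum_(i < n) (eigenvalues A)`_i * (v *m P^T) 0 i ^+ 2.
Proof.
move=> symA; have [P [d PP AE]] := real_spectral symA.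
have pE : perm_eq (eigenvalues A) (codom (d 0)).
  by apply: perm_eigenvalues; rewrite {1}AE orthogonal_char_poly.
have szd : size (codom (d 0)) == n by rewrite size_codom card_ord.
have /tuple_permP[s sE] : perm_eq (eigenvalues A) (Tuple szd) by [].
have evE (i : 'I_n) : (eigenvalues A)`_i = d 0 (s i).
  rewrite sE -tnth_nth tnth_mktuple.
  by rewrite (tnth_nth 0) /= (nth_map (s i)) ?size_enum_ord // nth_ord_enum.
have PsE (v : 'rV[R]_n) i : (v *m (row_perm s P)^T) 0 i = (v *m P^T) 0 (s i).
  by rewrite !mxE; apply: eq_bigr => k _; rewrite !mxE.
exists (row_perm s P) => [|v].
  apply/matrixP => i j; have /matrixP/(_ (s i) (s j)) := PP.
  rewrite !mxE (inj_eq perm_inj) => <-.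
  by apply: eq_bigr => k _; rewrite !mxE.
under eq_bigr do rewrite PsE evE.
rewrite [RHS](reindex_inj (h := perm_inv s)) ?perm_inj //=; last exact: perm_inj.
under eq_bigr do rewrite permKV.
rewrite /bform {1}AE !mulmxA -mulmxA -[P *m v^T]trmxK trmx_mul trmxK mxE.
by apply: eq_bigr => i _; rewrite mul_mx_diag !mxE; lra.
Qed.

End RealSpectral.

(** * Courant-Fischer inequalities *)

Section CourantFischer.
Variables (R : realType) (n : nat) (A : 'M[R]_n).
Hypothesis symA : A^T = A.
Local Notation ev := (eigenvalues A).

Lemma bform1_orthogonal (P : 'M[R]_n) (v : 'rV[R]_n) : P *m P^T = 1%:M ->
  bform 1%:M v v = \sum_i (v *m P^T) 0 i ^+ 2.
Proof.
move=> /mulmx1C PtP.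
rewrite /bform -PtP mulmxA -mulmxA -[P *m v^T]trmxK trmx_mul trmxK mxE.
by apply: eq_bigr => i _; rewrite [X in _ * X]mxE expr2.
Qed.

Lemma size_eigenvalues : size ev = n.
Proof.
have [P [d PP AE]] := real_spectral symA.
have /perm_size-> : perm_eq ev (codom (d 0)).
  by apply: perm_eigenvalues; rewrite {1}AE orthogonal_char_poly.
by rewrite size_codom card_ord.
Qed.

Lemma le_eigenvalues i j : (i <= j < n)%N -> ev`_j <= ev`_i.
Proof.
move=> /andP[ij jn].
apply: (sorted_leq_nth (leT := >=%R) _ _ _ (sorted_eigenvalues A)) => //.
- by move=> x y z /= yx zy; exact: le_trans zy yx.
- by move=> x /=.
- by rewrite inE size_eigenvalues (leq_ltn_trans ij).
- by rewrite inE size_eigenvalues.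
Qed.

Lemma bform_le_max v : bform A v v <= ev`_0 * bform 1%:M v v.
Proof.
have [P PP ->] := spectral_eigenvalues symA.
rewrite (bform1_orthogonal _ PP) mulr_sumr ler_sum // => i _.
by rewrite ler_wpM2r ?sqr_ge0 // le_eigenvalues // leq0n ltn_ord.
Qed.

Lemma bform_ge_min v : ev`_n.-1 * bform 1%:M v v <= bform A v v.
Proof.
have [P PP ->] := spectral_eigenvalues symA.
rewrite (bform1_orthogonal _ PP) mulr_sumr ler_sum // => i _.
have n0 : (0 < n)%N by apply: leq_ltn_trans (ltn_ord i).
by rewrite ler_wpM2r ?sqr_ge0 // le_eigenvalues // -ltnS prednK ?ltn_ord ?leqnn.
Qed.

Lemma eigenvalue_attained i : (i < n)%N ->
  exists2 v, bform 1%:M v v = 1 & bform A v v = ev`_i.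
Proof.
move=> i_n; have [P PP AE] := spectral_eigenvalues symA.
pose k := Ordinal i_n.
have vP : delta_mx 0 k *m P *m P^T = delta_mx 0 k :> 'rV[R]_n.
  by rewrite -mulmxA PP mulmx1.
have dE j : (delta_mx 0 k : 'rV[R]_n) 0 j ^+ 2 = (j == k)%:R.
  by rewrite mxE eqxx -natrX; case: (j == k).
exists (delta_mx 0 k *m P).
  rewrite (bform1_orthogonal _ PP) vP (bigD1 k) //= dE eqxx big1 ?addr0 // => j.
  by rewrite dE => /negPf ->.
rewrite AE vP (bigD1 k) //= dE eqxx mulr1 big1 ?addr0 // => j.
by rewrite dE => /negPf ->; rewrite mulr0.
Qed.

(** Some combination of u and w is orthogonal to the leading eigenvector. Only (s, t) is required to
    be nonzero, since u and w may be dependent. *)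
Lemma bform_le_second u w : exists s t, (s, t) != (0, 0) /\
  bform A (s *: u + t *: w) (s *: u + t *: w) <=
  ev`_1 * bform 1%:M (s *: u + t *: w) (s *: u + t *: w).
Proof.
have [P PP AE] := spectral_eigenvalues symA.
have [n0|n0] := posnP n.
  exists 1, 0; split; first by rewrite xpair_eqE oner_eq0.
  rewrite AE (bform1_orthogonal _ PP) !big1 ?mulr0 // => i _;
    by have := ltn_ord i; rewrite [X in (_ < X)%N]n0.
pose k := Ordinal n0.
have [s [t [st0 stk]]] : exists s t, (s, t) != (0, 0) /\
    s * (u *m P^T) 0 k + t * (w *m P^T) 0 k = 0.
  have [a0|a0] := eqVneq ((u *m P^T) 0 k) 0.
    by exists 1, 0; rewrite xpair_eqE oner_eq0 a0 mulr0 mul0r addr0.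
  exists (- (w *m P^T) 0 k), ((u *m P^T) 0 k).
  by rewrite xpair_eqE negb_and a0 orbT mulNr mulrC addNr.
exists s, t; split=> //.
have vk : ((s *: u + t *: w) *m P^T) 0 k = 0.
  by rewrite mulmxDl -!scalemxAl [LHS]mxE [X in X + _]mxE [X in _ + X]mxE.
rewrite AE (bform1_orthogonal _ PP) mulr_sumr ler_sum // => i _.
have [->|ik] := eqVneq i k; first by rewrite vk expr0n !mulr0.
rewrite ler_wpM2r ?sqr_ge0 // le_eigenvalues // ltn_ord andbT lt0n.
by apply: contra ik => /eqP i0; apply/eqP/val_inj.
Qed.

(** Orthogonality to u is one linear condition on the two coefficients of a combination of the two
    leading eigenvectors. *)
Lemma bform_ge_second u : (1 < n)%N -> exists2 v, v != 0 &
  bform 1%:M u v = 0 /\ ev`_1 * bform 1%:M v v <= bform A v v.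
Proof.
move=> n1; have [P PP AE] := spectral_eigenvalues symA.
pose k0 := Ordinal (ltnW n1); pose k1 := Ordinal n1.
pose e0 : 'rV[R]_n := delta_mx 0 k0; pose e1 : 'rV[R]_n := delta_mx 0 k1.
pose a := bform P^T u e0; pose b := bform P^T u e1.
have [s [t [st0 stk]]] : exists s t, (s, t) != (0, 0) /\ s * a + t * b = 0.
  have [a0|a0] := eqVneq a 0.
    by exists 1, 0; rewrite xpair_eqE oner_eq0 a0 mulr0 mul0r addr0.
  exists (- b), a.
  by rewrite xpair_eqE negb_and a0 orbT mulNr mulrC addNr.
pose x := s *: e0 + t *: e1.
have xP : x *m P *m P^T = x by rewrite -mulmxA PP mulmx1.
have xE i : x 0 i = s * (i == k0)%:R + t * (i == k1)%:R.
  by rewrite /x !mxE !eqxx.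
exists (x *m P).
  apply: contra st0 => /eqP x0; move: xP; rewrite x0 mul0mx => /esym /rowP xz.
  have := xz k0; rewrite xE eqxx mulr1 mulr0 addr0 mxE => ->.
  have := xz k1; rewrite xE eqxx mulr1 mulr0 add0r mxE => ->.
  exact: eqxx.
split.
  rewrite -stk -bform_combr -/x /bform trmx_mul mulmx1 mulmxA //.
rewrite AE (bform1_orthogonal _ PP) mulr_sumr ler_sum // => i _.
rewrite xP; have [i1|i1] := leqP i 1.
  by rewrite ler_wpM2r ?sqr_ge0 // le_eigenvalues // n1 i1.
have -> : x 0 i = 0.
  by rewrite xE -!val_eqE /= !gtn_eqF ?mulr0 ?addr0 // ltnW.
by rewrite expr0n !mulr0.
Qed.

End CourantFischer.

(** * Scalar inequalities for a quadratic form on a plane *)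

Section Estimates.
Variable R : realType.

(** AM-GM for s^2 N and t^2 W, carried out on squares: once b^2 is replaced by its bound, the two
    sides differ by (k (s^2 N - t^2 W))^2. *)
Lemma cross_term_le (s t b N W k : R) : 0 <= N -> 0 <= W -> 0 <= k ->
  b ^+ 2 <= k ^+ 2 * (N * W) -> 2 * s * t * b <= k * (s ^+ 2 * N + t ^+ 2 * W).
Proof.
move=> N0 W0 k0 bk; have s0 := sqr_ge0 s; have t0 := sqr_ge0 t.
apply: le_trans (ler_norm _) _.
rewrite -ler_sqr ?nnegrE ?normr_ge0 //; last first.
  by rewrite mulr_ge0 // addr_ge0 // mulr_ge0.
rewrite real_normK ?num_real //.
apply: (@le_trans _ _ (4 * s ^+ 2 * t ^+ 2 * (k ^+ 2 * (N * W)))).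
  have -> : (2 * s * t * b) ^+ 2 = 4 * s ^+ 2 * t ^+ 2 * b ^+ 2 by lra.
  by rewrite ler_wpM2l // mulr_ge0 // mulr_ge0.
rewrite -subr_ge0.
have -> : (k * (s ^+ 2 * N + t ^+ 2 * W)) ^+ 2 -
    4 * s ^+ 2 * t ^+ 2 * (k ^+ 2 * (N * W)) =
    (k * (s ^+ 2 * N - t ^+ 2 * W)) ^+ 2 by lra.
exact: sqr_ge0.
Qed.

(** Here a, b, c stand for A(u,u), A(u,w), A(w,w), N and W for |u|^2 and |w|^2, m for the top
    eigenvalue, and d bounds the second one. If c were too large, m would exceed 2 d + k, hence a
    would exceed (d + k) N. Then A - d would be positive on the plane even after k pays for the
    cross term, against the assumption on (s, t). *)
Lemma bform_le_of_degenerate (s t N W a b c d m k : R) :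
  (s, t) != (0, 0) -> 0 < N -> 0 <= W -> 0 <= k -> 0 <= d ->
  s ^+ 2 * a + 2 * s * t * b + t ^+ 2 * c <= d * (s ^+ 2 * N + t ^+ 2 * W) ->
  b ^+ 2 <= k ^+ 2 * (N * W) -> m * N - a <= d * N -> c <= m * W ->
  c <= (2 * d + k) * W.
Proof.
move=> st N0 W0 k0 d0 H bk ma cm; rewrite leNgt; apply/negP => cW.
have {}W0 : 0 < W.
  by rewrite lt0r W0 andbT; apply/eqP => W00; move: cm cW; rewrite W00; lra.
have m0 : 2 * d + k < m by rewrite -(ltr_pM2r W0); lra.
have aN : (d + k) * N < a by nra.
(* The sign of t is flipped to bound the cross term from below. *)
have bs : 2 * s * (- t) * b <= k * (s ^+ 2 * N + (- t) ^+ 2 * W).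
  by apply: cross_term_le => //; apply: ltW.
rewrite sqrrN in bs.
have {}H : s ^+ 2 * (a - (d + k) * N) + t ^+ 2 * (c - (d + k) * W) <= 0 by lra.
have s0 := sqr_ge0 s; have t0 := sqr_ge0 t.
have a0 : 0 < a - (d + k) * N by lra.
have c0 : 0 < c - (d + k) * W by nra.
have sa : 0 <= s ^+ 2 * (a - (d + k) * N) by rewrite mulr_ge0 // ltW.
have tc : 0 <= t ^+ 2 * (c - (d + k) * W) by rewrite mulr_ge0 // ltW.
move: st; rewrite xpair_eqE negb_and => /orP[] z0.
  have : 0 < s ^+ 2 * (a - (d + k) * N) by rewrite mulr_gt0 // exprn_even_gt0.
  by lra.
have : 0 < t ^+ 2 * (c - (d + k) * W) by rewrite mulr_gt0 // exprn_even_gt0.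
by lra.
Qed.

End Estimates.

(** * Spectral estimates for a form that is nearly a multiple of <u,v>^2 *)

Section MatrixEstimates.
Variables (R : realType) (n : nat) (A : 'M[R]_n) (d : R).
Hypotheses (symA : A^T = A) (n0 : (0 < n)%N) (d0 : 0 <= d).
Local Notation ev := (eigenvalues A).
Local Notation N := (n%:R : R).
Let u : 'rV[R]_n := const_mx 1.
(** For w orthogonal to u, A(u,w)^2 is at most [k ^+ 2 * (N * W)] with W = |w|^2, in both directions
    of the argument; [max_eigenvalue_le] dictates the factor 2. If d = o(n), then k = o(n). *)
Let k : R := Num.sqrt (2 * d * (N + d)).

Lemma bform1_const : bform 1%:M u u = N.
Proof.
rewrite bform1E (eq_bigr (fun=> 1)) => [|i _]; last by rewrite mxE mulr1.
by rewrite sumr_const card_ord.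
Qed.

(** The coefficient 1 is kept so that [bform_comb] and [cross_term_le] apply with t = 1. *)
Lemma const_decomposition (v : 'rV[R]_n) : exists s w,
  [/\ v = s *: u + 1 *: w, bform 1%:M u w = 0,
      bform 1%:M v v = s ^+ 2 * N + bform 1%:M w w
    & bform 1%:M u v = s * N].
Proof.
have N0 : N != 0 by rewrite pnatr_eq0 -lt0n.
pose s := bform 1%:M u v / N; pose w := v - s *: u.
have vE : v = s *: u + 1 *: w by rewrite scale1r addrC subrK.
have uv : bform 1%:M u v = s * N by rewrite divfK.
have uw : bform 1%:M u w = 0.
  by have := uv; rewrite {1}vE bform_combr bform1_const; lra.
exists s, w; split=> //.
by rewrite {1 2}vE bform_comb ?trmx1 // uw bform1_const; lra.
Qed.

Let k0 : 0 <= k. Proof. exact: sqrtr_ge0. Qed.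
Let k2 : k ^+ 2 = 2 * d * (N + d).
Proof. by rewrite sqr_sqrtr // !mulr_ge0 // addr_ge0 // ler0n. Qed.

(* Eigenvalues to quadratic form: as u is nearly an eigenvector for the largest
   eigenvalue, Cauchy-Schwarz for ev`_0 - A bounds the cross term between u and
   w; on the plane spanned by u and w the form then has to be small on w. *)
Lemma bform_le_ones : ev`_0 <= N -> ev`_0 - bform A u u / N <= d ->
  ev`_1 <= d -> - d <= ev`_n.-1 ->
  forall v, bform A v v <= bform 1%:M u v ^+ 2 + (2 * d + 2 * k) * bform 1%:M v v.
Proof.
move=> evN ev0 ev1 evn v.
have Npos : 0 < N by rewrite ltr0n.
have N0 : N != 0 by rewrite gt_eqF.
have [s [w [vE uw vv uv]]] := const_decomposition v.
pose W := bform 1%:M w w; pose a := bform A u u; pose b := bform A u w.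
pose c := bform A w w.
have W0 : 0 <= W by exact: bform1_ge0.
have aN : ev`_0 * N - a <= d * N.
  by rewrite -ler_pdivrMr // mulrBl mulfK.
have cW : c <= ev`_0 * W by exact: bform_le_max.
have aN2 : a <= ev`_0 * N by rewrite -bform1_const; exact: bform_le_max.
have cd : - d * W <= c.
  by apply: le_trans (bform_ge_min symA w); rewrite ler_wpM2r.
have bk : b ^+ 2 <= k ^+ 2 * (N * W).
  (* B is nonnegative and, as u and w are orthogonal, B(u,w) = - b. Moreover B(u,u) <= d N and
     B(w,w) <= (N + d) W. *)
  pose B := (ev`_0)%:M - A.
  have symB : B^T = B by rewrite /B linearB /= tr_scalar_mx symA.
  have BE x y : bform B x y = ev`_0 * bform 1%:M x y - bform A x y.
    by rewrite /B bformD2 bformN -[(ev`_0)%:M]scalemx1 bformscale.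
  have := bform_cauchy_schwarz symB u w.
  rewrite !BE uw mulr0 sub0r sqrrN bform1_const -/a -/b -/c -/W k2 => /(_ _) h.
  apply: le_trans (h _) _ => [x|]; first by rewrite BE subr_ge0 bform_le_max.
  apply: (@le_trans _ _ ((d * N) * ((N + d) * W))).
    have evW : ev`_0 * W <= N * W by rewrite ler_wpM2r.
    by apply: ler_pM => //; lra.
  have : 0 <= d * N * ((N + d) * W).
    by rewrite !mulr_ge0 ?addr_ge0 // ltW.
  by lra.
have [s' [t' [st]]] := bform_le_second symA u w.
rewrite !bform_comb ?trmx1 // uw bform1_const -/a -/b -/c -/W => H.
have cle : c <= (2 * d + k) * W.
  apply: (@bform_le_of_degenerate _ s' t' N W a b c d ev`_0 k) => //.
  apply: le_trans H _; rewrite mulr0 addr0 ler_wpM2r //.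
  by rewrite addr_ge0 // mulr_ge0 ?sqr_ge0 // ltW.
(* Assembly for v = s u + w: s^2 a is at most (s N)^2 = <u,v>^2, the cross term costs k |v|^2 and c
   costs (2 d + k) W. *)
have sb : 2 * s * 1 * b <= k * (s ^+ 2 * N + 1 ^+ 2 * W).
  by apply: cross_term_le => //; exact: ltW.
rewrite {1 2}vE bform_comb // -/a -/b -/c uv vv -/W.
have s0 : 0 <= s ^+ 2 by exact: sqr_ge0.
have sa : s ^+ 2 * a <= s ^+ 2 * (N * N).
  by rewrite ler_wpM2l // (le_trans aN2) // ler_wpM2r // ?ltW.
have dsN : 0 <= d * (s ^+ 2 * N) by rewrite mulr_ge0 // mulr_ge0 // ltW.
have ksN : 0 <= k * (s ^+ 2 * N) by rewrite mulr_ge0 // mulr_ge0 // ltW.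
have kW : 0 <= k * W by rewrite mulr_ge0.
by lra.
Qed.

(** * From bounds on the form back to bounds on the eigenvalues *)

Hypotheses (A0 : 0 <= bform A u u) (AN : bform A u u <= N * N).
Hypotheses (Alo : forall v, - d * bform 1%:M v v <= bform A v v).
Hypotheses (Ahi : forall v,
  bform A v v <= d * bform 1%:M v v + bform 1%:M u v ^+ 2).

(** A unit top eigenvector is split as s u + w. Since s^2 N <= 1, the part along u contributes at
    most A(u,u) / N, the cross term at most k and w at most d. *)
Lemma max_eigenvalue_le : ev`_0 <= bform A u u / N + (k + d).
Proof.
have Npos : 0 < N by rewrite ltr0n.
have [v v1 <-] := eigenvalue_attained symA n0.
have [s [w [vE uw vv uv]]] := const_decomposition v.
pose W := bform 1%:M w w; pose a := bform A u u; pose b := bform A u w.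
pose c := bform A w w.
have W0 : 0 <= W by exact: bform1_ge0.
have cW : c <= d * W by have := Ahi w; rewrite uw expr0n addr0.
have bk : b ^+ 2 <= k ^+ 2 * (N * W).
  (* B is nonnegative by [Alo], with B(u,u) <= (N + d) N and B(w,w) <= 2 d W; the product of these
     bounds is exactly k^2 N W. *)
  pose B := d%:M + A.
  have symB : B^T = B by rewrite /B linearD /= tr_scalar_mx symA.
  have BE x y : bform B x y = d * bform 1%:M x y + bform A x y.
    by rewrite /B bformD2 -[d%:M]scalemx1 bformscale.
  have psdB x : 0 <= bform B x x by rewrite BE; have := Alo x; lra.
  have := bform_cauchy_schwarz symB u w psdB; have := psdB u; have := psdB w.
  rewrite !BE uw mulr0 add0r bform1_const -/a -/b -/c -/W k2 => c0 a0.
  move/le_trans; apply.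
  apply: (@le_trans _ _ (((N + d) * N) * (2 * d * W))); last lra.
  have aN : a <= N * N by exact: AN.
  by apply: ler_pM => //; lra.
have sb : 2 * s * 1 * b <= k * (s ^+ 2 * N + 1 ^+ 2 * W).
  by apply: cross_term_le => //; exact: ltW.
rewrite {1 2}vE bform_comb // -/a -/b -/c.
move: vv; rewrite v1 -/W => vv.
have sN : s ^+ 2 * N <= 1 by lra.
have sNW : 0 <= s ^+ 2 * N by rewrite mulr_ge0 ?sqr_ge0 // ltW.
have sa : s ^+ 2 * a <= a / N.
  by rewrite ler_pdivlMr // mulrAC ler_piMl.
have : d * W <= d * 1 by rewrite ler_wpM2l //; lra.
have kE : k * (s ^+ 2 * N + 1 ^+ 2 * W) = k.
  by rewrite expr1n mul1r -vv mulr1.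
rewrite kE in sb.
by lra.
Qed.

(** On the hyperplane orthogonal to u the square in [Ahi] vanishes. *)
Lemma second_eigenvalue_le : (1 < n)%N -> ev`_1 <= d.
Proof.
move=> n1; have [v v0 [uv]] := bform_ge_second symA u n1.
have vv : 0 < bform 1%:M v v by rewrite lt0r bform1_eq0 v0 bform1_ge0.
move=> /le_trans/(_ (Ahi v)); rewrite uv expr0n addr0.
by rewrite ler_pM2r.
Qed.

End MatrixEstimates.

(** * Adjacency matrices *)

Section GraphMatrix.
Variables (R : realType) (n : nat).
Implicit Type G : sgraph n.
Local Notation ones := (const_mx 1 : 'rV[R]_n).

Lemma adjmx_sym G : (adjmx R G)^T = adjmx R G.
Proof. by apply/matrixP => i j; rewrite !mxE adj_sym. Qed.

Lemma adjmx_compl G :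
  adjmx R (compl_graph G) = const_mx 1 - 1%:M - adjmx R G.
Proof.
apply/matrixP => i j; rewrite !mxE /= /compl_adj /=.
have [->|ij] := eqVneq i j; first by rewrite adj_irrefl /= mulr1n !subrr ?subr0.
by case: (G i j) => /=; lra.
Qed.

Lemma bform_const_mx (v : 'rV[R]_n) :
  bform (const_mx 1) v v = bform 1%:M ones v ^+ 2.
Proof.
rewrite bformE bform1E expr2 mulr_suml; apply: eq_bigr => i _.
rewrite mulr_sumr; apply: eq_bigr => j _.
by rewrite !mxE !mul1r mulr1.
Qed.

Lemma bform_compl G v : bform (adjmx R (compl_graph G)) v v =
  bform 1%:M ones v ^+ 2 - bform 1%:M v v - bform (adjmx R G) v v.
Proof. by rewrite adjmx_compl !bformD2 !bformN bform_const_mx. Qed.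

(** Termwise, v_i v_j <= (v_i^2 + v_j^2) / 2. This crude bound yields both mu_1 <= n and 2 e(G) <=
    n^2. *)
Lemma bform_adjmx_le G v : bform (adjmx R G) v v <= n%:R * bform 1%:M v v.
Proof.
rewrite bformE bform1E.
apply: (@le_trans _ _ (\sum_(i < n) \sum_(j < n)
  (v 0 i ^+ 2 / 2 + v 0 j ^+ 2 / 2))).
  apply: ler_sum => i _; apply: ler_sum => j _; rewrite mxE.
  have := sqr_ge0 (v 0 i - v 0 j); have := sqr_ge0 (v 0 i).
  have := sqr_ge0 (v 0 j); by case: (G i j) => /=; lra.
pose S := \sum_(i < n) v 0 i ^+ 2 / 2.
rewrite (eq_bigr (fun i => n%:R * (v 0 i ^+ 2 / 2) + S)); last first.
  by move=> i _; rewrite big_split /= sumr_const card_ord mulr_natl.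
rewrite big_split /= -mulr_sumr sumr_const card_ord -[S *+ n]mulr_natl -mulrDr.
rewrite ler_wpM2l // /S -big_split /= ler_sum // => i _; lra.
Qed.

(** Adjacent ordered pairs are grouped by their underlying edge; as there are no loops, each fibre
    is {(x, y), (y, x)} with two distinct elements. *)
Lemma sum_nb_edges G : (\sum_(i < n) \sum_(j < n) G i j = 2 * nb_edges G)%N.
Proof.
rewrite pair_bigA /= /nb_edges /edges.
rewrite (eq_bigr (fun p : 'I_n * 'I_n => if G p.1 p.2 then 1 else 0)%N); last first.
  by move=> p _; case: (G _ _).
rewrite -big_mkcond /=.
rewrite (partition_big_imset (fun p : 'I_n * 'I_n => [set p.1; p.2]%SET)) /=.
rewrite mulnC -sum_nat_const; apply: eq_big => [e|e /imsetP[[x y]] /= Gxy ->].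
  by apply/imsetP/imsetP => -[p Gp ->]; exists p => //; move: Gp; rewrite inE.
rewrite sum1dep_card (_ : [set _ | _]%SET = [set (x, y); (y, x)]%SET).
  rewrite cards2 xpair_eqE; case: eqP => // xy.
  by move: Gxy; rewrite unfold_in /= xy adj_irrefl.
apply/setP => -[a b]; rewrite !inE /= !xpair_eqE.
have {}Gxy : G x y by [].
apply/andP/orP => [[Gab /eqP abE]|].
  have ab : a != b by apply: contraTneq Gab => ->; rewrite unfold_in /= adj_irrefl.
  have : a \in [set x; y]%SET by rewrite -abE !inE eqxx.
  have : b \in [set x; y]%SET by rewrite -abE !inE eqxx orbT.
  rewrite !inE => /orP[] /eqP bE /orP[] /eqP aE; subst a b;
    rewrite ?eqxx ?(negPf ab); move: ab; rewrite ?eqxx //; by auto.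
by case=> /andP[/eqP-> /eqP->]; rewrite unfold_in /= ?(adj_sym G y x) Gxy
  ?eqxx // finset.setUC eqxx.
Qed.

Lemma bform_adjmx_ones G : bform (adjmx R G) ones ones = 2 * (nb_edges G)%:R.
Proof.
rewrite -natrM -sum_nb_edges bformE natr_sum; apply: eq_bigr => i _.
by rewrite natr_sum; apply: eq_bigr => j _; rewrite !mxE mul1r mulr1.
Qed.

Lemma mu_out G k : (n <= k.-1)%N -> mu R k G = 0.
Proof.
by move=> nk; rewrite /mu nth_default // size_eigenvalues ?adjmx_sym.
Qed.

(** Without loops the form vanishes at a basis vector. Applied to G and its complement, this makes
    the two summands of the theorem equal in sign, so they cannot cancel. *)
Lemma mu_min_le0 G : mu R n G <= 0.
Proof.
have [n0|n0] := posnP n; first by rewrite mu_out // {1}n0.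
have := bform_ge_min (adjmx_sym G) (delta_mx 0 (Ordinal n0)).
by rewrite !bform_deltar mulmx1 -rowE !mxE !eqxx adj_irrefl /= mulr1.
Qed.

Lemma mu_min_ge G c : (0 < n)%N ->
  (forall v, - c * bform 1%:M v v <= bform (adjmx R G) v v) -> - c <= mu R n G.
Proof.
move=> n0 Gc; rewrite /mu.
have [|v v1 <-] := eigenvalue_attained (adjmx_sym G) (i := n.-1).
  by rewrite prednK.
by have := Gc v; rewrite v1 mulr1.
Qed.

Lemma mu_max_le G : (0 < n)%N -> mu R 1 G <= n%:R.
Proof.
move=> n0; rewrite /mu /=.
have [v v1 <-] := eigenvalue_attained (adjmx_sym G) n0.
by have := bform_adjmx_le G v; rewrite v1 mulr1.
Qed.

(** The 1 pays for the term - |v|^2 in [bform_compl]; the rest is the error in [bform_le_ones]. *)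
Lemma mu_compl_ge G d : (0 < n)%N -> 0 <= d ->
  mu R 1 G - 2 * (nb_edges G)%:R / n%:R <= d -> mu R 2 G <= d ->
  - d <= mu R n G ->
  - (1 + 2 * d + 2 * Num.sqrt (2 * d * (n%:R + d))) <= mu R n (compl_graph G).
Proof.
move=> n0 d0 mu1 mu2 mun; apply: mu_min_ge => // v.
rewrite bform_compl.
have := bform_le_ones (adjmx_sym G) n0 d0 (mu_max_le G n0) _ mu2 mun v.
by rewrite bform_adjmx_ones => /(_ mu1); lra.
Qed.

Lemma quasi_random_estimates G d : (0 < n)%N -> 0 <= d ->
  - d <= mu R n G -> - d <= mu R n (compl_graph G) ->
  let e := Num.sqrt (2 * (d + 1) * (n%:R + (d + 1))) + (d + 1) in
  `|mu R 1 G - 2 * (nb_edges G)%:R / n%:R| <= e /\ `|mu R 2 G| <= d + 1.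
Proof.
move=> n0 d0 mun muc e; set A := adjmx R G.
have symA : A^T = A by exact: adjmx_sym.
have N0 : 0 < n%:R :> R by rewrite ltr0n.
have d1 : 0 <= d + 1 by lra.
have pos (v : 'rV[R]_n) : 0 <= bform 1%:M v v by exact: bform1_ge0.
have Alo v : - (d + 1) * bform 1%:M v v <= bform A v v.
  have := bform_ge_min symA v.
  have : - d * bform 1%:M v v <= mu R n G * bform 1%:M v v.
    by rewrite ler_wpM2r.
  by rewrite -/(mu R n G); have := pos v; lra.
(* Through [bform_compl], a lower bound for the complement is an upper bound for G. *)
have Ahi v : bform A v v <= (d + 1) * bform 1%:M v v + bform 1%:M ones v ^+ 2.
  have := bform_ge_min (adjmx_sym (compl_graph G)) v.
  have : - d * bform 1%:M v v <= mu R n (compl_graph G) * bform 1%:M v v.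
    by rewrite ler_wpM2r.
  by rewrite -/(mu R n (compl_graph G)) bform_compl; have := pos v; lra.
have A0 : 0 <= bform A ones ones by rewrite bform_adjmx_ones mulr_ge0.
have AN : bform A ones ones <= n%:R * n%:R.
  by rewrite -{2}bform1_const bform_adjmx_le.
have s0 : 0 <= Num.sqrt (2 * (d + 1) * (n%:R + (d + 1))) by exact: sqrtr_ge0.
split; rewrite ler_norml; apply/andP; split.
(* The average degree is the Rayleigh quotient at the all-ones vector. *)
- have : 2 * (nb_edges G)%:R / n%:R <= mu R 1 G.
    rewrite ler_pdivrMr // -bform_adjmx_ones -[X in _ * X]bform1_const.
    exact: bform_le_max.
  by rewrite /e; lra.
- have := max_eigenvalue_le symA n0 d1 A0 AN Alo Ahi.
  by rewrite bform_adjmx_ones /e /mu -/A; lra.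
(* For n = 1 the value of [mu R 2 G] is the default 0; otherwise mu_2 >= mu_n. *)
- have [n1|n1] := leqP n 1; first by rewrite mu_out //; lra.
  apply: le_trans (_ : mu R n G <= _); first by lra.
  by apply: le_eigenvalues; rewrite //= -ltnS prednK // n1 /=.
- have [n1|n1] := leqP n 1; first by rewrite mu_out //; lra.
  exact: second_eigenvalue_le.
Qed.

End GraphMatrix.

(** For n > 0 the quotient equals the square root of 2 (d/n) (1 + d/n), which tends to 0 by
    continuity. *)
Lemma sqrt_error_cvg (R : realType) (d : nat -> R) :
  d n / n%:R @[n --> \oo] --> (0 : R) ->
  Num.sqrt (2 * d n * (n%:R + d n)) / n%:R @[n --> \oo] --> (0 : R).
Proof.
move=> dn.
have lim0 : Num.sqrt (2 * (d n / n%:R) * (1 + d n / n%:R)) @[n --> \oo] --> (0 : R).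
  rewrite -[X in _ --> X]sqrtr0.
  apply: continuous_cvg; first exact: sqrt_continuous.
  have -> : (0 : R) = 2 * 0 * (1 + 0) by rewrite mulr0 mul0r.
  apply: cvgM; first by apply: cvgM => //; exact: cvg_cst.
  by apply: cvgD => //; exact: cvg_cst.
apply: cvg_trans lim0; apply: near_eq_cvg; near=> n.
have n0 : 0 < n%:R :> R by rewrite ltr0n; near: n; exact: nbhs_infty_gt.
have -> : 2 * (d n / n%:R) * (1 + d n / n%:R) =
    2 * d n * (n%:R + d n) / n%:R ^+ 2.
  have -> : 1 + d n / n%:R = (n%:R + d n) / n%:R by rewrite mulrDl mulfV ?gt_eqF.
  by rewrite -exprVn; lra.
(* [sqrtrM] asks only its first factor to be nonnegative, so the inverse square goes first and [d n]
   may have any sign. *)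
rewrite [_ / _ ^+ 2]mulrC sqrtrM ?invr_ge0 ?sqr_ge0 // sqrtrV ?sqr_ge0 //.
by rewrite sqrtr_sqr gtr0_norm // mulrC.
Unshelve. all: by end_near.
Qed.

(** * Uniform error terms *)

Section LittleO.
Variable R : realType.
Implicit Types f g : nat -> R.

Lemma little_oD f g :
  f n / n%:R @[n --> \oo] --> (0 : R) -> g n / n%:R @[n --> \oo] --> (0 : R) ->
  (f n + g n) / n%:R @[n --> \oo] --> (0 : R).
Proof.
move=> f0 g0; under eq_fun do rewrite mulrDl.
by have := cvgD f0 g0; rewrite addr0; apply.
Qed.

Lemma little_oZ (c : R) f : f n / n%:R @[n --> \oo] --> (0 : R) ->
  (c * f n) / n%:R @[n --> \oo] --> (0 : R).
Proof.
move=> f0; under eq_fun do rewrite -mulrA.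
by have := cvgM (cvg_cst c) f0; rewrite mulr0; apply.
Qed.

Lemma little_o_norm f : f n / n%:R @[n --> \oo] --> (0 : R) ->
  `|f n| / n%:R @[n --> \oo] --> (0 : R).
Proof.
move=> f0; have := cvg_norm f0; rewrite normr0.
under eq_fun do rewrite normrM normfV normr_nat.
by apply.
Qed.

Lemma little_o1 : 1 / n%:R @[n --> \oo] --> (0 : R).
Proof.
under eq_fun do rewrite div1r.
apply/(gtr0_cvgV0 (f := fun n => n%:R)); last exact: cvgr_idn.
by near=> n; rewrite ltr0n; near: n; exact: nbhs_infty_gt.
Unshelve. all: by end_near.
Qed.

End LittleO.

Theorem theorem1 (R : realType) (F : graph_family) (infF : infinite_set F) :
  quasi_random R F <->
  exists f : nat -> R,
    [/\ (forall n : nat, 0 <= f n),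
        (f n / n%:R @[n --> \oo] --> (0 : R))
      & (forall (n : nat) (G : sgraph n), F (existT _ n G) ->
           `|mu R n G + mu R n (compl_graph G)| <= f n)].
Proof.
split=> [[[g1 [g1o mu1]] [g2 [g2o mu2]] [gn [gno mun]]]|[f [f0 fo mun]]].
  (* One error term dominates all three. Absolute values are taken because a bound may be negative
     at an order with no member of the family. *)
  pose d n := `|g1 n| + `|g2 n| + `|gn n|.
  have d0 n : 0 <= d n by rewrite !addr_ge0.
  have od : d n / n%:R @[n --> \oo] --> (0 : R).
    by apply: little_oD; [apply: little_oD|]; exact: little_o_norm.
  (* The first [d n] is for G, the remainder is the bound of [mu_compl_ge] for its complement. *)
  exists (fun n => d n + (1 + 2 * d n + 2 * Num.sqrt (2 * d n * (n%:R + d n)))).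
  split=> [n||n G FG].
  - by rewrite !addr_ge0 // mulr_ge0 // sqrtr_ge0.
  - apply: little_oD => //; apply: little_oD; last first.
      exact: (little_oZ 2 (sqrt_error_cvg od)).
    by apply: little_oD; [exact: little_o1|exact: little_oZ].
  have g1d : g1 n <= d n.
    by have := ler_norm (g1 n); have := normr_ge0 (g2 n);
       have := normr_ge0 (gn n); rewrite /d; lra.
  have g2d : g2 n <= d n.
    by have := ler_norm (g2 n); have := normr_ge0 (g1 n);
       have := normr_ge0 (gn n); rewrite /d; lra.
  have gnd : gn n <= d n.
    by have := ler_norm (gn n); have := normr_ge0 (g1 n);
       have := normr_ge0 (g2 n); rewrite /d; lra.
  have min0 := mu_min_le0 R G; have cmin0 := mu_min_le0 R (compl_graph G).
  rewrite ler0_norm; last lra.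
  (* At order 0 both values are the default 0. *)
  have [n0|n0] := posnP n.
    rewrite !mu_out ?n0 //; have := d0 0%N.
    by have := sqrtr_ge0 (2 * d 0%N * (0%:R + d 0%N)); lra.
  have := mu1 _ _ FG; rewrite ler_norml => /andP[_ mu1G].
  have := mu2 _ _ FG; rewrite ler_norml => /andP[_ mu2G].
  have := mun _ _ FG; rewrite ler_norml => /andP[munG _].
  have lo : - d n <= mu R n G by lra.
  by have := mu_compl_ge n0 (d0 n) (le_trans mu1G g1d) (le_trans mu2G g2d) lo; lra.
pose d n := f n + 1.
have od : d n / n%:R @[n --> \oo] --> (0 : R).
  by apply: little_oD => //; exact: little_o1.
pose e n := Num.sqrt (2 * d n * (n%:R + d n)) + d n.
have eo : e n / n%:R @[n --> \oo] --> (0 : R).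
  by apply: little_oD => //; exact: sqrt_error_cvg.
have de n : d n <= e n by rewrite lerDr sqrtr_ge0.
have main n (G : sgraph n) : F (existT _ n G) ->
    [/\ `|mu R 1 G - 2 * (nb_edges G)%:R / n%:R| <= e n, `|mu R 2 G| <= d n
      & `|mu R n G| <= d n].
  move=> FG; have fn := f0 n; have d0 : 0 <= d n by rewrite /d; lra.
  have e0 := le_trans d0 (de n).
  have min0 := mu_min_le0 R G; have cmin0 := mu_min_le0 R (compl_graph G).
  have := mun _ _ FG; rewrite ler0_norm; last lra.
  (* Both summands are nonpositive, so a bound on their sum bounds each of them. *)
  move=> munG; have lo : - f n <= mu R n G by lra.
  have clo : - f n <= mu R n (compl_graph G) by lra.
  have [n0|n0] := posnP n.
    (* At order 0 the quotient 2 e / n is 0 too, the inverse of 0 being 0. *)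
    have nR : n%:R = 0 :> R by rewrite n0.
    by rewrite !mu_out ?n0 // nR invr0 mulr0 subrr normr0.
  have [mu1G mu2G] := quasi_random_estimates n0 fn lo clo.
  by split=> //; rewrite ler0_norm // /d; lra.
split.
- by exists e; split=> // n G /main[].
- by exists d; split=> // n G /main[].
- by exists d; split=> // n G /main[].
Qed.
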